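(* Let $d\ge1$, $n\in\{1,2,\dots\}\cup\{\infty\}$, and let $\{\xi(i,m)\}$, $1\le i\le n$ ($i$ finite), $m=1,\dots,d$, be centered martingale differences relative to one common filtration $\{F(i)\}$, such that the random vectors $\vec\xi(m)=\{\xi(i,m)\}_i$, $m=1,\dots,d$, are independent. Put $\nu_m(p)=\sup_i|\xi(i,m)|_p$ and assume that, for each $m$, $\nu_m\in G(\nu,r_m)$ for some $2<r_m<\infty$. Define for $p\ge2$ $$\zeta_1(p)=K_M(p)\,\nu_1(p),\qquad \zeta_{m+1}(p)=K_M(p)\,\zeta_m(p)\,\nu_{m+1}(p),\quad m=1,\dots,d-1,$$ that is, $\zeta_d(p)=K_M^d(p)\prod_{m=1}^d\nu_m(p)$. Then $$\sup_{b\in B(d,n)}\|Q(d,n,b)\|G(\zeta_d)\ \le\ \prod_{m=1}^d\|\vec\xi(m)\|G(\nu_m,r_m),$$ where, with $s=\min_m r_m$, $\|Q\|G(\zeta_d)=\sup_{p\in(2,s)}|Q|_p/\zeta_d(p)$ and $\|\vec\xi(m)\|G(\nu_m,r_m)=\sup_{p\in(2,r_m)}\sup_i|\xi(i,m)|_p/\nu_m(p)$.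
   Context: All random variables live on a probability space $(\Omega,F,\mathbf P)$; $|\xi|_p=(\mathbf E|\xi|^p)^{1/p}$. Suprema of nonnegative quantities over the empty set are $0$. Martingale differences: $F(0)=\{\emptyset,\Omega\}$, $F(i)\subset F(i+1)\subset F$; each $\xi(i,m)$ is $F(i)$-measurable, $\mathbf E\xi(i,m)=0$, and $\mathbf E[\xi(i,m)\mid F(k)]=0$ a.s. for all $k=0,1,\dots,i-1$. The filtration is the same for all $m=1,\dots,d$. Polynomial: $I(d,n)=\{(i_1,\dots,i_d):1\le i_1<i_2<\dots<i_d\le n\}$ (finite indices); for a real non-random array $b=(b(I))_{I\in I(d,n)}$, $$Q(d,n,b)=\sum_{I=(i_1,\dots,i_d)\in I(d,n)}b(I)\prod_{m=1}^d\xi(i_m,m).$$ For $n=\infty$, $Q(d,\infty,b)=\lim_{n\to\infty}Q(d,n,b)$, for those $b$ for which this limit exists with probability one. $B(d,n)=\{b:\sum_{I\in I(d,n)}b^2(I)=1\}$. Class $G(\nu,r)$ ($r>2$): functions $\nu$ that are continuous, positive and finite on $[1,r)$, with $\inf_{p\in(2,r)}\nu(p)>0$ and $\nu(p)=\infty$ for $p>r$. Constant $K_M(p)$, $p\ge2$: the smallest constant $K$ such that for every finite $n$, every sequence $\theta(1),\dots,\theta(n)$ of centered martingale differences relative to some filtration, and all real $b(1),\dots,b(n)$ with $\sum_i b^2(i)=1$, one has $\left|\sum_{i=1}^n b(i)\theta(i)\right|_p\le K\sup_i|\theta(i)|_p$. (It is known that $K_M(p)\le p\sqrt2$.) *)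

(* Defs.v *)
From HB Require Import structures.
From mathcomp Require Import all_boot all_order all_algebra.
From mathcomp Require Import all_classical all_reals all_analysis.

Set Implicit Arguments.
Unset Strict Implicit.
Unset Printing Implicit Defensive.

Import Order.TTheory GRing.Theory Num.Theory.
Import numFieldNormedType.Exports.

Local Open Scope classical_set_scope.
Local Open Scope ring_scope.

(* Supremum of a set of nonnegative extended reals, with sup of the empty set
   equal to 0 (the library's [ereal_sup set0] is -oo). *)
Definition nnsup (R : realType) (A : set (\bar R)) : \bar R :=
  ereal_sup (0%E |` A).

(* The length n is [Some N] for a finite N, and [None] for n = oo. *)
Definition indices (n : option nat) : set nat :=
  [set i | (1 <= i)%N /\ (if n is Some N then (i <= N)%N else true)].

Section Probability.
Context (R : realType) (disp : measure_display) (T : measurableType disp)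
        (P : probability T R).
Implicit Types (X Y : T -> R) (G : set (set T)).

Definition measurable_wrt G X : Prop :=
  forall B : set R, measurable B -> G (X @^-1` B).

(* Y is a version of E[X | G]. *)
Definition is_cond_exp G X Y : Prop :=
  [/\ P.-integrable setT (EFin \o X),
      P.-integrable setT (EFin \o Y),
      measurable_wrt G Y &
      forall A, G A ->
        (\int[P]_(x in A) (X x)%:E = \int[P]_(x in A) (Y x)%:E)%E].

Definition is_filtration (F : nat -> set (set T)) : Prop :=
  [/\ F 0 = [set set0; setT],
      forall i, sigma_algebra setT (F i),
      forall i, F i `<=` F i.+1 &
      forall i, F i `<=` measurable].

Definition martingale_differences (n : option nat) (F : nat -> set (set T))
    (theta : nat -> {RV P >-> R}) : Prop :=
  forall i, indices n i ->
    [/\ measurable_wrt (F i) (theta i),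
        ('E_P[theta i] = 0)%E &
        forall k, (k < i)%N -> is_cond_exp (F k) (theta i) (cst 0)].

(* sigma-algebra generated by the (possibly infinite) random vector (X_i)_i *)
Definition sigma_vector (n : option nat) (X : nat -> {RV P >-> R}) :
    set (set T) :=
  <<s \bigcup_(i in indices n) preimage_set_system setT (X i) measurable >>.

Definition independent_vectors (d : nat) (n : option nat)
    (X : 'I_d -> nat -> {RV P >-> R}) : Prop :=
  forall (J : {set 'I_d}) (A : 'I_d -> set T),
    (forall m, m \in J -> sigma_vector n (X m) (A m)) ->
    P (\bigcap_(m in [set` J]) A m) = (\prod_(m in J) P (A m))%E.

Definition pnorm (p : R) X : \bar R := 'N[P]_(p%:E)[EFin \o X]%E.

(* sup_i |X_i|_p *)
Definition sup_pnorm (n : option nat) (X : nat -> {RV P >-> R}) (p : R) :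
    \bar R :=
  nnsup [set pnorm p (X i) | i in indices n].

(* ||(X_i)_i|| G(nu, r) *)
Definition Gnorm_vector (n : option nat) (X : nat -> {RV P >-> R})
    (nu : R -> \bar R) (r : R) : \bar R :=
  nnsup [set nnsup [set (pnorm p (X i) / nu p)%E | i in indices n]
       | p in [set p : R | (2 < p < r)%R]].

(* ||X|| G(zeta), the supremum being over the interval (2, s) *)
Definition Gnorm (X : T -> R) (zeta : R -> \bar R) (s : \bar R) : \bar R :=
  nnsup [set (pnorm p X / zeta p)%E
       | p in [set p : R | (2 < p) /\ (p%:E < s)%E]].

End Probability.

Definition classG (R : realType) (r : R) (nu : R -> \bar R) : Prop :=
  [/\ {within `[1, r[%classic, continuous nu},
      forall p : R, 1 <= p < r -> (0 < nu p)%E /\ (nu p < +oo)%E,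
      (0 < ereal_inf [set nu p | p in [set p : R | (2 < p < r)%R]])%E &
      forall p : R, r < p -> nu p = +oo%E].

(* The constants K admissible in the definition of K_M(p), over all
   probability spaces. *)
Definition KM_bound (R : realType) (p K : R) : Prop :=
  forall (disp : measure_display) (T : measurableType disp)
    (P : probability T R) (n : nat) (F : nat -> set (set T))
    (theta : nat -> {RV P >-> R}) (b : nat -> R),
    is_filtration F ->
    martingale_differences (Some n) F theta ->
    \sum_(1 <= i < n.+1) b i ^+ 2 = 1 ->
    (pnorm P p (fun w => (\sum_(1 <= i < n.+1) b i * theta i w)%R)
       <= K%:E * sup_pnorm (Some n) theta p)%E.

(* The infimum is taken in the extended reals, so that the definition does not
   presuppose the finiteness of K_M(p); a finite infimum is attained. *)
Definition KM (R : realType) (p : R) : \bar R :=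
  ereal_inf [set K%:E | K in KM_bound p].

Definition Iset (d : nat) (n : option nat) : set (d.-tuple nat) :=
  [set I : d.-tuple nat | sorted ltn I /\ forall m, indices n (tnth I m)].
Arguments Iset : clear implicits.

Definition Bset (R : realType) (d : nat) (n : option nat) :
    set (d.-tuple nat -> R) :=
  [set b | (\esum_(I in Iset d n) (b I ^+ 2)%:E = 1)%E].
Arguments Bset : clear implicits.

Section Polynomial.
Context (R : realType) (disp : measure_display) (T : measurableType disp)
        (P : probability T R) (d : nat).
Variable xi : nat -> 'I_d -> {RV P >-> R}.

Definition Qfin (n : nat) (b : d.-tuple nat -> R) (w : T) : R :=
  \sum_(I \in Iset d (Some n)) (b I * \prod_(m < d) xi (tnth I m) m w).

Definition Q (n : option nat) (b : d.-tuple nat -> R) (w : T) : R :=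
  if n is Some N then Qfin N b w
  else limn (fun N => Qfin N b w).

(* The b for which Q(d,n,b) is defined. *)
Definition Q_defined (n : option nat) (b : d.-tuple nat -> R) : Prop :=
  if n is Some _ then True
  else {ae P, forall w, cvgn (fun N => Qfin N b w)}.

End Polynomial.

Definition zeta (R : realType) (d : nat) (nu : 'I_d -> R -> \bar R) (p : R) :
    \bar R :=
  (KM p ^+ d * \prod_(m < d) nu m p)%E.

(* Main.v *)
Require Import Defs.
From HB Require Import structures.
From mathcomp Require Import all_boot all_order all_algebra.
From mathcomp Require Import all_classical all_reals all_analysis measurable_realfun.
Import Order.TTheory GRing.Theory Num.Theory.
Import numFieldNormedType.Exports.
Local Open Scope classical_set_scope.
Local Open Scope ring_scope.

Set Implicit Arguments.
Unset Strict Implicit.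
Unset Printing Implicit Defensive.

(** For each [m] the factor [||xi(m)|| G(nu_m, r_m)] is at least [1], because
    [nu_m] is itself the supremum of the norms.  It remains to see that
    [|Q|_p <= K_M(p)^d * prod_m nu_m(p)] for [2 < p < s].  By induction on [d]:
    collecting the terms of [Q] with largest index [i],
    [Q(d) = sum_i c_i theta_i] with [theta_i = c_i^-1 * Q_i * xi(i, d)], where
    [Q_i] is a polynomial of degree [d - 1] in the [xi(j, m)], [j < i], [m < d],
    and [c_i^2] is the sum of its squared coefficients.  As [Q_i] is
    [F(i-1)]-measurable, the [theta_i] are martingale differences, and since
    [Q_i] is independent of [xi(i, d)],
    [|theta_i|_p = |c_i^-1 Q_i|_p |xi(i, d)|_p], so the definition of [K_M(p)]
    gives one more factor [K_M(p) * nu_d(p)].  The case [n = oo] follows by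
    Fatou's lemma. *)

(** * Measurability with respect to a sub-sigma-algebra *)

Section SubSigmaAlgebra.
Context (R : realType) (disp : measure_display) (T : measurableType disp).
Implicit Types (X Y : T -> R) (G : set (set T)).

(** A sigma-algebra [G] is the one it generates, so [measurable_wrt G] inherits the closure
    properties of measurable functions on [g_sigma_algebraType G]. *)
Lemma measurable_wrtP G X : sigma_algebra setT G ->
  measurable_wrt G X <-> measurable_fun setT (X : g_sigma_algebraType G -> R).
Proof.
move=> sG; split=> [mX _ B mB | mX B mB].
  by rewrite setTI; apply: sub_sigma_algebra; exact: mX.
by have := mX measurableT B mB; rewrite setTI /measurable/= sigma_algebra_id.
Qed.

Lemma measurable_wrt_fun G X : G `<=` measurable ->
  measurable_wrt G X -> measurable_fun setT X.
Proof. by move=> Gm mX _ B mB; rewrite setTI; apply/Gm/mX. Qed.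

Lemma measurable_wrtW G G' X : G `<=` G' ->
  measurable_wrt G X -> measurable_wrt G' X.
Proof. by move=> GG' mX B mB; apply/GG'/mX. Qed.

Lemma measurable_wrt_cst G (c : R) : sigma_algebra setT G ->
  measurable_wrt G (cst c : T -> R).
Proof. by move=> sG; apply/measurable_wrtP => //; exact: measurable_cst. Qed.

Lemma measurable_wrtM G X Y : sigma_algebra setT G ->
  measurable_wrt G X -> measurable_wrt G Y ->
  measurable_wrt G (fun w => X w * Y w).
Proof.
move=> sG /(measurable_wrtP _ sG) mX /(measurable_wrtP _ sG) mY.
by apply/(measurable_wrtP _ sG); exact: measurable_funM.
Qed.

Lemma measurable_wrt_sum G (I : eqType) (s : seq I) (X : I -> T -> R) :
  sigma_algebra setT G -> (forall i, i \in s -> measurable_wrt G (X i)) ->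
  measurable_wrt G (fun w => \sum_(i <- s) X i w).
Proof.
move=> sG mX; apply/(measurable_wrtP _ sG).
under eq_fun do rewrite big_seq big_mkcond.
apply: measurable_sum => i; case: (boolP (i \in s)) => [si|_]; first exact/(measurable_wrtP _ sG)/mX.
exact: measurable_cst.
Qed.

Lemma measurable_wrt_funrpos G X : sigma_algebra setT G ->
  measurable_wrt G X -> measurable_wrt G X^\+.
Proof.
move=> sG /(measurable_wrtP _ sG) mX; apply/(measurable_wrtP _ sG).
exact: measurable_funrpos.
Qed.

Lemma measurable_wrt_funrneg G X : sigma_algebra setT G ->
  measurable_wrt G X -> measurable_wrt G X^\-.
Proof.
move=> sG /(measurable_wrtP _ sG) mX; apply/(measurable_wrtP _ sG).
exact: measurable_funrneg.
Qed.

End SubSigmaAlgebra.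

(** * Orthogonality to functions measurable for a sub-sigma-algebra *)

Section Orthogonality.
Context (R : realType) (disp : measure_display) (T : measurableType disp)
        (P : probability T R) (G : set (set T)).
Hypotheses (sG : sigma_algebra setT G) (Gm : G `<=` measurable).
Implicit Types X Y : T -> R.

Import HBNNSimple.

(** [X] is a limit of [G]-measurable simple functions [f n]; each [f n * Y] integrates to 0 level
    set by level set, and dominated convergence with bound [|X * Y|] gives the limit. *)
Let ge0_integral_orthogonal X Y :
  measurable_wrt G X -> (forall w, 0 <= X w) ->
  P.-integrable setT (EFin \o Y) ->
  P.-integrable setT (EFin \o (fun w => X w * Y w)) ->
  (forall A, G A -> (\int[P]_(w in A) (Y w)%:E = 0)%E) ->
  (\int[P]_w (X w * Y w)%:E = 0)%E.
Proof.
move=> mX X0 iY iXY Y0.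
have /measurable_EFinP mX' := (measurable_wrtP X sG).1 mX.
(* The approximation is made on the space carrying [G], so that the level sets of [f n] lie in
   [G]. *)
pose f := nnsfun_approx (@measurableT _ (g_sigma_algebraType G)) mX'.
have f_cvg w : f n w @[n --> \oo] --> X w.
  have /= H := @cvg_nnsfun_approx _ (g_sigma_algebraType G) _ setT measurableT _ mX'
    (fun x _ => X0 x) w I.
  by have /fine_cvgP[_] := H.
have f_le n w : f n w <= X w.
  rewrite -(cvg_lim _ (f_cvg w)) //; apply: nondecreasing_cvgn_le.
    by move=> a b ab; exact/lefP/nd_nnsfun_approx.
  by apply/cvg_ex; exists (X w); exact: f_cvg.
have mY : measurable_fun setT Y by apply/measurable_EFinP/(measurable_int P).
have f_level n y : G (f n @^-1` [set y]).
  have := measurable_funPT (f n) measurableT _ (measurable_set1 y).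
  by rewrite setTI /measurable/= sigma_algebra_id.
have mf n : measurable_fun setT (f n : T -> R).
  apply: (measurable_wrt_fun Gm); apply/(measurable_wrtP _ sG).
  exact: (measurable_funPT (f n)).
have mXY : measurable_fun setT (EFin \o (fun w => X w * Y w)).
  exact: (measurable_int P).
have int0 n : (\int[P]_w (f n w * Y w)%:E = 0)%E.
  have mA y : measurable (f n @^-1` [set y] : set T) by exact/Gm.
  have YA y : (fun w => (y * \1_(f n @^-1` [set y]) w * Y w)%:E) =
      (fun w => y%:E * ((EFin \o Y) \_ (f n @^-1` [set y])) w)%E.
    by apply/funext => w; rewrite restrict_EFin -EFinM patchE indicE;
       case: ifPn => _ /=; rewrite ?(mulr1, mul1r, mulr0, mul0r).
  have iYA y : P.-integrable setT ((EFin \o Y) \_ (f n @^-1` [set y])).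
    apply/(integrable_mkcond _ _).1 => //.
    exact: integrableS iY.
  have rng : finite_set (range (f n)) by exact: fimfunP.
  under eq_integral.
    move=> w _; rewrite fimfunE fsbig_finite// mulr_suml -sumEFin.
    over.
  rewrite /= integral_sum//; last by move=> y; rewrite YA; exact: integrableZl.
  by apply: big1 => y _; rewrite YA integralZl// -integral_mkcond Y0// mule0.
have [||_ _] := @dominated_convergence _ T R P setT measurableT
  (fun n w => (f n w * Y w)%:E) (EFin \o (fun w => X w * Y w))
  (abse \o (EFin \o (fun w => X w * Y w)))
  (fun n => (measurable_EFinP _ _).2 (measurable_funM (mf n) mY))
  mXY _ (integrable_abse iXY).
- apply: aeW => w _; apply: cvg_EFin; first exact: nearW.
  exact: (cvgM (f_cvg w) (cvg_cst _)).
- apply: aeW => w n _ /=; rewrite lee_fin !normrM ler_wpM2r//.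
  by rewrite !ger0_norm.
rewrite (_ : [sequence _]_n = cst 0%E); last exact/funext.
by move/(cvg_unique (@ereal_hausdorff R) (cvg_cst _)).
Qed.

(** [X] splits into its positive and negative parts; both products with [Y] are integrable, being
    dominated by [|X * Y|]. *)
Lemma integral_orthogonal X Y :
  measurable_wrt G X ->
  P.-integrable setT (EFin \o Y) ->
  P.-integrable setT (EFin \o (fun w => X w * Y w)) ->
  (forall A, G A -> (\int[P]_(w in A) (Y w)%:E = 0)%E) ->
  (\int[P]_w (X w * Y w)%:E = 0)%E.
Proof.
move=> mX iY iXY Y0.
have mY : measurable_fun setT Y by apply/measurable_EFinP/(measurable_int P).
have [mXp mXn] : measurable_wrt G X^\+ /\ measurable_wrt G X^\-.
  by split; [exact: measurable_wrt_funrpos|exact: measurable_wrt_funrneg].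
have dom (Z : T -> R) : measurable_wrt G Z -> (forall w, `|Z w| <= `|X w|) ->
    P.-integrable setT (EFin \o (fun w => Z w * Y w)).
  move=> mZ ZX; apply: (le_integrable _ _ _ iXY) => //.
    by apply/measurable_EFinP/measurable_funM => //; exact: measurable_wrt_fun mZ.
  by move=> w _ /=; rewrite lee_fin !normrM ler_wpM2r.
have XE w : X w = X^\+ w - X^\- w.
  exact: esym (congr1 (@^~ w) (funrposBneg X)).
have aXE w : `|X w| = X^\+ w + X^\- w.
  exact: esym (congr1 (@^~ w) (funrposDneg X)).
have ip : P.-integrable setT (EFin \o (fun w => X^\+ w * Y w)).
  apply: dom => // w; rewrite aXE.
  by rewrite ger0_norm ?lerDl.
have im : P.-integrable setT (EFin \o (fun w => X^\- w * Y w)).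
  apply: dom => // w; rewrite aXE.
  by rewrite ger0_norm ?lerDr.
under eq_integral.
  move=> w _; rewrite XE mulrBl EFinB; over.
rewrite /= integralB_EFin// !ge0_integral_orthogonal ?sube0//.
Qed.

End Orthogonality.

(** * Independence of random variables and of random vectors *)

Section Independence.
Context (R : realType) (disp : measure_display) (T : measurableType disp)
        (P : probability T R).

(* The joint law of [X] and [Y] is the product of their laws, so the claim is
   Tonelli's theorem for [(x, y) |-> f x * g y]. *)
Lemma ge0_integral_independentM (X Y : T -> R) (f g : R -> \bar R) :
  measurable_fun setT X -> measurable_fun setT Y ->
  (forall A B, measurable A -> measurable B ->
    P (X @^-1` A `&` Y @^-1` B) = P (X @^-1` A) * P (Y @^-1` B))%E ->
  measurable_fun setT f -> (forall x, 0 <= f x)%E ->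
  measurable_fun setT g -> (forall y, 0 <= g y)%E ->
  (\int[P]_w (f (X w) * g (Y w)) =
   \int[P]_w f (X w) * \int[P]_w g (Y w))%E.
Proof.
move=> mX mY indep mf f0 mg g0.
have mXY : measurable_fun setT (fun w => (X w, Y w)) by exact/measurable_fun_pair.
pose X' : {RV P >-> R} := mfun_Sub (mem_set mX).
pose Y' : {RV P >-> R} := mfun_Sub (mem_set mY).
pose XY : {mfun T >-> (R * R)%type} := mfun_Sub (mem_set mXY).
pose h (z : (R * R)%type) : \bar R := (f z.1 * g z.2)%E.
have mh : measurable_fun setT h.
  by apply: emeasurable_funM; apply: measurableT_comp.
have law : forall A, measurable A ->
    (distribution P X' \x distribution P Y')%E A = distribution P XY A.
  apply: product_measure_unique => A B mA mB.
  rewrite /distribution /pushforward/=.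
  exact: indep.
transitivity (\int[distribution P XY]_z h z)%E.
  by rewrite ge0_integral_pushforward// => z _; rewrite mule_ge0.
rewrite -(@eq_measure_integral _ _ _ setT _ _ _ (fun A mA _ => law A mA)).
rewrite fubini_tonelli1//; last by move=> z; rewrite mule_ge0.
rewrite /fubini_F/h/=.
under eq_integral do rewrite ge0_integralZl//.
rewrite ge0_integralZr//; last exact: integral_ge0.
by rewrite !ge0_integral_pushforward.
Qed.

Lemma sigma_vectorT (n : option nat) (X : nat -> {RV P >-> R}) :
  sigma_vector n X setT.
Proof. exact: (@measurableT _ (g_sigma_algebraType _)). Qed.

Lemma sigma_vectorI (n : option nat) (X : nat -> {RV P >-> R}) A B :
  sigma_vector n X A -> sigma_vector n X B -> sigma_vector n X (A `&` B).
Proof. exact: (@measurableI _ (g_sigma_algebraType _)). Qed.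

Lemma sigma_vector_sub (n : option nat) (X : nat -> {RV P >-> R}) :
  sigma_vector n X `<=` measurable.
Proof.
apply: smallest_sub; first exact: sigma_algebra_measurable.
move=> _ [i _ [B mB <-]]; exact: measurable_funPT.
Qed.

Lemma measurable_wrt_sigma_vector (n : option nat) (X : nat -> {RV P >-> R}) i :
  indices n i -> measurable_wrt (sigma_vector n X) (X i).
Proof.
by move=> ni B mB; apply: sub_sigma_algebra; exists i => //; exists B => //;
  rewrite setTI.
Qed.

(** A pi-system argument: intersections of one event per vector in [J] generate the joint
    sigma-algebra, and on them the finite measures sending [A] to P(A and B) and to P(B) P(A)
    agree. *)
Lemma independent_vectors_join (d : nat) (n : option nat)
    (X : 'I_d -> nat -> {RV P >-> R}) (J : {set 'I_d}) (k : 'I_d) (A B : set T) :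
  independent_vectors n X -> k \notin J ->
  <<s \bigcup_(m in [set` J]) sigma_vector n (X m) >> A ->
  sigma_vector n (X k) B ->
  P (A `&` B) = (P A * P B)%E.
Proof.
move=> indep kJ sA sB.
pose Pi := [set \bigcap_(m in [set` J]) A m
           | A in [set A : 'I_d -> set T | forall m, sigma_vector n (X m) (A m)]].
have PiE : <<s \bigcup_(m in [set` J]) sigma_vector n (X m) >> `<=` <<s Pi >>.
  apply: smallest_sub; first exact: smallest_sigma_algebra.
  move=> C [m /= mJ mC]; apply: sub_sigma_algebra.
  (* An event of the single vector [m] is such an intersection, with [setT] for the other
     vectors. *)
  exists (fun j => if j == m then C else setT).
    move=> j /=; case: eqP => [->//|_].
    exact: sigma_vectorT.
  apply/seteqP; split => [w /(_ m mJ)|w Cw j _] /=; first by rewrite eqxx.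
  by case: eqP.
have mB : measurable B by exact: sigma_vector_sub sB.
have PB : (P B = (fine (P B))%:E)%E by rewrite fineK// fin_num_measure.
have PB0 : (0 <= fine (P B))%R by rewrite fine_ge0.
rewrite muleC PB.
apply: (@g_sigma_algebra_measure_unique _ R T Pi _ (fun=> setT) _ _
  (mrestr P mB) (mscale (NngNum PB0) P) _ _ _ A (PiE _ sA)).
- move=> _ [C mC <-]; apply: fin_bigcap_measurable => // m _.
  exact: sigma_vector_sub (mC m).
- move=> _; exists (fun=> setT); last exact: bigcapT.
  by move=> m; exact: sigma_vectorT.
- exact: bigcup_const.
- move=> _ _ [C mC <-] [D mD <-]; exists (fun m => C m `&` D m).
    by move=> m; exact: sigma_vectorI.
  by rewrite bigcapI.
- move=> _ [C mC <-].
  change (P (\bigcap_(m in [set` J]) C m `&` B) =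
          (fine (P B))%:E * P (\bigcap_(m in [set` J]) C m))%E.
  (* Placing [B] at the index [k] outside [J] reduces the claim to independence over [J] enlarged by
     [k]. *)
  pose C' m := if m == k then B else C m.
  have C'J m : m \in J -> C' m = C m.
    by move=> mJ; rewrite /C' ifN//; apply: contraNneq kJ => <-.
  have := indep (k |: J)%SET C'; rewrite big_setU1//=.
  rewrite [C' k]ifT// -PB.
  rewrite (eq_bigr (P \o C)) => [|m mJ]; last by rewrite /= C'J.
  rewrite -(indep J) => [|m _]; last exact: mC.
  move=> <- => [|m _]; last first.
    by rewrite /C'; case: eqP => [->//|_]; exact: mC.
  congr (P _); apply/seteqP; split => [w [wC wB] m|w wC'].
    by rewrite /= !inE => /orP[/eqP ->|mJ]; [rewrite /C' eqxx|rewrite C'J//; exact: wC].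
  split => [m mJ|].
    by rewrite -C'J//; apply: wC'; rewrite /= !inE mJ orbT.
  by have := wC' k; rewrite /C' eqxx; apply; rewrite /= setU11.
- move=> _; apply: (@le_lt_trans _ _ 1%E); last exact: ltry.
  exact: (probability_le1 P (measurableI _ _ measurableT mB)).
Qed.

End Independence.

(** * Moments and their product rule under independence *)

Section Pnorm.
Context (R : realType) (disp : measure_display) (T : measurableType disp)
        (P : probability T R).
Implicit Types (X Y : T -> R) (p : R).

Lemma pnormE p X : pnorm P p X = ((\int[P]_w (`|X w| `^ p)%:E) `^ p^-1)%E.
Proof. by rewrite /pnorm unlock. Qed.

Lemma pnorm_ge0 p X : (0 <= pnorm P p X)%E.
Proof. exact: Lnorm_ge0. Qed.

Lemma measurable_normr_powR p : measurable_fun setT (fun x : R => (`|x| `^ p)%:E).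
Proof.
apply/measurable_EFinP; apply: (measurableT_comp (measurable_powR p)).
exact: normr_measurable.
Qed.

Lemma pnorm_cst p (c : R) : 0 < p -> pnorm P p (cst c) = `|c|%:E.
Proof.
move=> p0; rewrite pnormE (integral_cst P measurableT (`|c| `^ p)%:E)/= probability_setT mule1.
by rewrite poweR_EFin -powRrM divff ?gt_eqF// powRr1.
Qed.

Lemma pnormZ p (a : R) X : 0 < p -> measurable_fun setT X ->
  pnorm P p (fun w => a * X w) = (`|a|%:E * pnorm P p X)%E.
Proof.
move=> p0 mX; rewrite !pnormE.
under eq_integral do rewrite normrM powRM// EFinM.
have mXp : measurable_fun setT (fun w => (`|X w| `^ p)%:E).
  exact: (measurableT_comp (measurable_normr_powR p)).
rewrite ge0_integralZl//.
rewrite poweRM ?lee_fin ?powR_ge0//; last first.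
  by apply: integral_ge0 => w _; rewrite lee_fin powR_ge0.
by rewrite poweR_EFin -powRrM divff ?gt_eqF// powRr1.
Qed.

Definition independent_rv X Y := forall A B : set R, measurable A -> measurable B ->
  (P (X @^-1` A `&` Y @^-1` B) = P (X @^-1` A) * P (Y @^-1` B))%E.

Lemma pnorm_independentM p X Y : measurable_fun setT X -> measurable_fun setT Y ->
  independent_rv X Y ->
  pnorm P p (fun w => X w * Y w) = (pnorm P p X * pnorm P p Y)%E.
Proof.
move=> mX mY XY; rewrite !pnormE.
under eq_integral do rewrite normrM powRM// EFinM.
have m0 (x : R) : (0 <= (`|x| `^ p)%:E)%E by rewrite lee_fin powR_ge0.
rewrite (ge0_integral_independentM mX mY XY (measurable_normr_powR p) m0
  (measurable_normr_powR p) m0).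
by rewrite poweRM//; apply: integral_ge0.
Qed.

(** Independence gives E|XY| = E|X| E|Y|, which is finite. *)
Lemma integrable_independentM X Y : independent_rv X Y ->
  P.-integrable setT (EFin \o X) -> P.-integrable setT (EFin \o Y) ->
  P.-integrable setT (EFin \o (fun w => X w * Y w)).
Proof.
move=> XY /integrableP[mX iX] /integrableP[mY iY].
have {}mX : measurable_fun setT X by exact/measurable_EFinP.
have {}mY : measurable_fun setT Y by exact/measurable_EFinP.
apply/integrableP; split; first exact/measurable_EFinP/measurable_funM.
under eq_integral do rewrite /= normrM EFinM.
have mn : measurable_fun setT (fun x : R => `|x|%:E).
  by apply/measurable_EFinP; exact: normr_measurable.
rewrite (ge0_integral_independentM mX mY XY mn (fun=> _) mn (fun=> _))//.
by rewrite lte_mul_pinfty// ?ge0_fin_numE//; exact: integral_ge0.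
Qed.

End Pnorm.

(** * Martingale differences multiplied by predictable factors *)

Section MartingaleDifferences.
Context (R : realType) (disp : measure_display) (T : measurableType disp)
        (P : probability T R).

Lemma filtration_le (F : nat -> set (set T)) i j :
  is_filtration F -> (i <= j)%N -> F i `<=` F j.
Proof.
move=> [_ _ FS _] /subnK <-; elim: (j - i)%N => [//|k IH].
by rewrite addSn; exact: (subset_trans IH).
Qed.

(** The known factor is taken out and [G] is lowered to [H] at once: for [A] in [H], the function
    [\1_A * Z] is [G]-measurable, hence orthogonal to [Y]. *)
Lemma is_cond_exp0M (G H : set (set T)) (Z Y : T -> R) :
  sigma_algebra setT G -> G `<=` measurable ->
  sigma_algebra setT H -> H `<=` G ->
  measurable_wrt G Z -> P.-integrable setT (EFin \o (fun w => Z w * Y w)) ->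
  is_cond_exp P G Y (cst 0) ->
  is_cond_exp P H (fun w => Z w * Y w) (cst 0).
Proof.
move=> sG Gm sH HG mZ iZY [iY i0 _ Y0]; split => //.
  exact: measurable_wrt_cst.
move=> A HA; rewrite integral0.
have GA := HG _ HA; have mA := Gm _ GA.
have mIZ : measurable_wrt G (fun w => \1_A w * Z w).
  apply: measurable_wrtM => //; apply/(measurable_wrtP _ sG).
  apply: measurable_indic; exact: sub_sigma_algebra.
have IE w : (\1_A w * Z w * Y w)%:E =
    ((EFin \o (fun w => Z w * Y w)) \_ A) w.
  rewrite patchE indicE; case: ifPn => _ /=.
    by rewrite mul1r.
  by rewrite !mul0r.
have iIZY : P.-integrable setT (EFin \o (fun w => \1_A w * Z w * Y w)).
  rewrite (_ : _ \o _ = (EFin \o (fun w => Z w * Y w)) \_ A); last exact/funext.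
  by apply/(integrable_mkcond _ _).1 => //; exact: integrableS iZY.
rewrite integral_mkcond; under eq_integral do rewrite -IE.
apply: (integral_orthogonal sG Gm mIZ iY iIZY) => B GB.
by rewrite Y0// integral0.
Qed.

End MartingaleDifferences.

(** * Recursive form of the polynomial *)

Section Chaos.
Context (R : realType).

(* [Q(d, N, b)] written recursively by summing over the last, that is the
   largest, index first; multi-indices are plain sequences. *)
Fixpoint chaos (T : Type) (X : nat -> nat -> T -> R) (d : nat)
    (b : seq nat -> R) (N : nat) (w : T) : R :=
  if d is d'.+1 then
    \sum_(1 <= i < N.+1) chaos X d' (fun s => b (rcons s i)) i.-1 w * X i d' w
  else b [::].

(** Follows the recursion of [chaos], so that its summands are the c_i^2 of the induction. *)
Fixpoint sqsum (d : nat) (b : seq nat -> R) (N : nat) : R :=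
  if d is d'.+1 then
    \sum_(1 <= i < N.+1) sqsum d' (fun s => b (rcons s i)) i.-1
  else b [::] ^+ 2.

Lemma sqsum_ge0 d b N : 0 <= sqsum d b N.
Proof.
elim: d b N => [|d IH] b N /=; first exact: sqr_ge0.
by apply: sumr_ge0 => i _.
Qed.

(** A zero sum of squares has only zero terms, at every level. This settles the cases where
    normalising would divide by 0. *)
Lemma sqsum_eq0_chaos (T : Type) (X : nat -> nat -> T -> R) d b N w :
  sqsum d b N = 0 -> chaos X d b N w = 0.
Proof.
elim: d b N => [|d IH] b N /= => [/eqP|].
  by rewrite sqrf_eq0 => /eqP.
move=> /eqP; rewrite psumr_eq0 => [/allP S0|i _]; last exact: sqsum_ge0.
rewrite big_seq; apply: big1 => i /S0 /eqP H.
by rewrite IH ?mul0r.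
Qed.

End Chaos.

(** * Moment bound by induction on the degree *)

Section MomentBound.
Context (R : realType) (disp : measure_display) (T : measurableType disp)
        (P : probability T R) (D : nat) (n : option nat)
        (F : nat -> set (set T)) (X : nat -> nat -> {RV P >-> R}).
Hypotheses (Ffil : is_filtration F)
  (Xmart : forall m, (m < D)%N -> martingale_differences n F (X^~ m))
  (Xindep : independent_vectors n (fun (m : 'I_D) i => X i m)).

(** Says that [N] does not exceed the length [n]; [valid 0] holds vacuously, which matters for inner
    polynomials ending at [i.-1]. *)
Let valid N := forall i, (1 <= i <= N)%N -> indices n i.

Let validW N i : valid N -> (i <= N)%N -> valid i.
Proof. by move=> vN iN j /andP[j1 ji]; apply: vN; rewrite j1 (leq_trans ji). Qed.

Let sF i : sigma_algebra setT (F i). Proof. by case: Ffil. Qed.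
Let Fm i : F i `<=` measurable. Proof. by case: Ffil. Qed.

(** The term with last index [i <= N] involves only variables [X j m] with [j <= i]. *)
Lemma measurable_wrt_chaos d b N : (d <= D)%N -> valid N ->
  measurable_wrt (F N) (chaos X d b N).
Proof.
elim: d b N => [|d IH] b N dD vN /=; first exact: measurable_wrt_cst.
apply: measurable_wrt_sum => // i; rewrite mem_index_iota ltnS => /andP[i1 iN].
apply: measurable_wrtM => //.
  apply: (measurable_wrtW (filtration_le Ffil (leq_trans (leq_pred i) iN))).
  by apply: IH; [exact: ltnW|exact: validW (leq_trans (leq_pred i) iN)].
apply: (measurable_wrtW (filtration_le Ffil iN)).
by have [] := Xmart dD (vN i (introT andP (conj i1 iN))).
Qed.

Lemma measurable_chaos d b N : measurable_fun setT (chaos X d b N).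
Proof.
elim: d b N => [|d IH] b N /=; first exact: measurable_cst.
by apply: measurable_sum => i; apply: measurable_funM.
Qed.

Let below d : {set 'I_D} := [set m : 'I_D | (m < d)%N]%SET.
(** The joint sigma-algebra of the vectors 0, ..., d - 1, to be set against the vector [d]. *)
Let Sg d := <<s \bigcup_(m in [set` below d]) sigma_vector n (fun i => X i m) >>.

Let sSg d : sigma_algebra setT (Sg d). Proof. exact: smallest_sigma_algebra. Qed.

Let measurable_wrt_Sg_chaos d b N : (d <= D)%N -> valid N ->
  measurable_wrt (Sg d) (chaos X d b N).
Proof.
elim: d b N => [|d IH] b N dD vN /=; first exact: measurable_wrt_cst.
apply: measurable_wrt_sum => // i; rewrite mem_index_iota ltnS => /andP[i1 iN].
apply: measurable_wrtM => //.
  have SS : Sg d `<=` Sg d.+1.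
    apply: sub_smallest2r; first exact: smallest_sigma_algebra.
    apply: bigcup_subset => m /=.
    by rewrite !inE => /ltnW.
  apply: (measurable_wrtW SS).
  by apply: IH; [exact: ltnW|exact: validW (leq_trans (leq_pred i) iN)].
apply: (@measurable_wrtW _ _ _ (sigma_vector n (X^~ d))).
  apply: subset_trans (@sub_sigma_algebra _ _ _).
  by apply: (bigcup_sup (i := Ordinal dD)); rewrite /= inE /=.
by apply: measurable_wrt_sigma_vector; apply: vN; rewrite i1.
Qed.

(** The polynomial of degree [d] is [Sg d]-measurable, whereas [X i d] belongs to the vector [d]. *)
Lemma independent_chaos d b N i : (d < D)%N -> valid N -> indices n i ->
  independent_rv P (chaos X d b N) (X i d).
Proof.
move=> dD vN ni A B mA mB.
apply: (independent_vectors_join (k := Ordinal dD) (J := below d) Xindep).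
- by rewrite inE ltnn.
- exact: measurable_wrt_Sg_chaos (ltnW dD) vN A mA.
- exact: measurable_wrt_sigma_vector ni B mB.
Qed.

Let integrable_X d i : (d < D)%N -> indices n i ->
  P.-integrable setT (EFin \o X i d).
Proof.
move=> dD ni; have [_ _ /(_ 0)] := Xmart dD ni.
by case: ni => i1 _ /(_ i1) [].
Qed.

Lemma integrable_chaos d b N : (d <= D)%N -> valid N ->
  P.-integrable setT (EFin \o chaos X d b N).
Proof.
elim: d b N => [|d IH] b N dD vN /=.
  exact: finite_measure_integrable_cst.
(* The range is repeated as a filter to make the bounds on [i] available for each term. *)
rewrite (_ : _ \o _ = fun w => (\sum_(1 <= i < N.+1 | (1 <= i < N.+1)%N)
    (chaos X d (fun s => b (rcons s i)) i.-1 w * X i d w)%:E)%E); last first.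
  by apply/funext => w /=; rewrite -sumEFin big_nat.
apply: integrable_sum => // i /andP[i1]; rewrite ltnS => iN.
have ni : indices n i by apply: vN; rewrite i1.
have vi : valid i.-1 by exact: validW (leq_trans (leq_pred i) iN).
apply: integrable_independentM (IH _ _ (ltnW dD) vi) (integrable_X dD ni).
exact: independent_chaos.
Qed.

Section Bound.
Variables (p k : R) (v : nat -> R).
Hypotheses (p0 : 0 < p) (k0 : 0 <= k) (v0 : forall m, 0 <= v m).
Hypothesis Xv : forall m i, (m < D)%N -> indices n i ->
  (pnorm P p (X i m) <= (v m)%:E)%E.
(** The defining inequality of K_M(p), with a real [k] and any bound [s] in place of the
    supremum. *)
Hypothesis kP : forall N (theta : nat -> {RV P >-> R}) (a : nat -> R) (s : R),
  martingale_differences (Some N) F theta ->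
  \sum_(1 <= i < N.+1) a i ^+ 2 = 1 -> 0 <= s ->
  (forall i, (1 <= i <= N)%N -> (pnorm P p (theta i) <= s%:E)%E) ->
  (pnorm P p (fun w => \sum_(1 <= i < N.+1) a i * theta i w)%R <= (k * s)%:E)%E.

(** The factor [Num.sqrt (sqsum d b N)] makes the bound homogeneous in [b], so the induction
    hypothesis applies to the inner polynomials without normalising them. *)
Lemma pnorm_chaos d b N : (d <= D)%N -> valid N ->
  (pnorm P p (chaos X d b N) <=
   (k ^+ d * \prod_(m < d) v m * Num.sqrt (sqsum d b N))%:E)%E.
Proof.
elim: d b N => [|d IH] b N dD vN.
  by rewrite /= expr0 big_ord0 !mul1r sqrtr_sqr -(pnorm_cst P (b [::]) p0).
have [S0|Sn0] := eqVneq (sqsum d.+1 b N) 0.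
  have -> : chaos X d.+1 b N = cst 0.
    by apply/funext => w; exact: sqsum_eq0_chaos S0.
  by rewrite pnorm_cst// normr0 S0 sqrtr0 mulr0.
pose bi i := (fun s => b (rcons s i)).
pose c i := Num.sqrt (sqsum d (bi i) i.-1).
pose S := Num.sqrt (sqsum d.+1 b N).
have S_gt0 : 0 < S by rewrite sqrtr_gt0 lt_def Sn0 sqsum_ge0.
(* If [c i] is 0 then so is its inverse, and [Z i] vanishes. *)
pose Z i w := (c i)^-1 * chaos X d (bi i) i.-1 w.
have mZ i : measurable_fun setT (Z i).
  by apply: measurable_funM => //; exact: measurable_chaos.
have mth i : measurable_fun setT (fun w => Z i w * X i d w).
  exact: measurable_funM.
pose theta i : {RV P >-> R} := mfun_Sub (mem_set (mth i)).
pose s := k ^+ d * (\prod_(m < d) v m) * v d.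
have s0 : 0 <= s.
  by rewrite !mulr_ge0// ?exprn_ge0//; apply: prodr_ge0.
have vp i : (1 <= i <= N)%N -> valid i.-1.
  by move=> /andP[_ iN]; exact: validW (leq_trans (leq_pred i) iN).
(* The weights [c i / S] have squares summing to 1, as K_M(p) requires. *)
have chaosE w : chaos X d.+1 b N w =
    S * \sum_(1 <= i < N.+1) (c i / S) * theta i w.
  rewrite mulr_sumr /=; apply: eq_big_nat => i _.
  rewrite /Z -/(bi i) !mulrA.
  have [ci0|ci0] := eqVneq (c i) 0.
    rewrite ci0 !(mul0r, mulr0) sqsum_eq0_chaos ?mul0r//; apply/eqP.
    by rewrite eq_le sqsum_ge0 andbT -sqrtr_eq0 -/(c i) ci0.
  by rewrite (mulrAC S) divff ?gt_eqF// mul1r divff// mul1r.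
have c2 i : c i ^+ 2 = sqsum d (bi i) i.-1 by rewrite sqr_sqrtr ?sqsum_ge0.
have -> : chaos X d.+1 b N =
    (fun w => S * \sum_(1 <= i < N.+1) (c i / S) * theta i w) by exact/funext.
rewrite pnormZ//; last first.
  by apply: measurable_sum => i; apply: measurable_funM.
rewrite (ger0_norm (ltW S_gt0)) -/S.
rewrite (_ : k ^+ d.+1 * _ * S = S * (k * s)); last first.
  by rewrite exprS big_ord_recr /= /s mulrC !mulrA.
rewrite EFinM lee_pmul2l ?lte_fin//; apply: kP => //.
- move=> i [i1 iN]; have i1N : (1 <= i <= N)%N by rewrite i1.
  have ni := vN i i1N; have vi := vp i i1N.
  have [XF X0 Xc] := Xmart dD ni.
  have ip : (i.-1 < i)%N by rewrite prednK.
  (* [Z i] is known at time [i - 1], which makes [theta] a sequence of martingale differences. *)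
  have mZF : measurable_wrt (F i.-1) (Z i).
    apply: measurable_wrtM => //; first exact: measurable_wrt_cst.
    by apply: measurable_wrt_chaos => //; exact: ltnW.
  have iZX : P.-integrable setT (EFin \o (fun w => Z i w * X i d w)).
    rewrite (_ : _ \o _ = fun w => ((c i)^-1%:E *
        (chaos X d (bi i) i.-1 w * X i d w)%:E)%E); last first.
      by apply/funext => w; rewrite /= -EFinM /Z mulrA.
    apply: integrableZl => //; apply: integrable_independentM.
    + exact: independent_chaos.
    + by apply: integrable_chaos => //; exact: ltnW.
    + exact: integrable_X.
  have ce j : (j < i)%N -> is_cond_exp P (F j) (theta i) (cst 0).
    move=> ji; apply: (is_cond_exp0M (sF i.-1) (@Fm i.-1) (sF j)) => //.
      by apply: filtration_le => //; rewrite -ltnS prednK.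
    exact: Xc.
  split => //.
  + apply: measurable_wrtM => //.
    by apply: measurable_wrtW mZF; apply: filtration_le => //; exact: leq_pred.
  (* The mean is read off from conditioning on the trivial [F 0], over the event [setT]. *)
  + have [_ _ _ /(_ setT)] := ce 0%N i1; rewrite integral0 unlock; apply.
    by have [-> _ _ _] := Ffil; right.
- under eq_bigr do rewrite expr_div_n c2.
  by rewrite -mulr_suml sqr_sqrtr ?sqsum_ge0// divff.
- move=> i i1N; have ni := vN i i1N; have vi := vp i i1N.
  rewrite (_ : theta i = (fun w => Z i w * X i d w) :> (T -> R))//.
  rewrite pnorm_independentM//; last first.
    move=> A B mA mB.
    (* Scaling by [(c i)^-1] is moved into the event, so that independence for [chaos] applies. *)
    have mA' : measurable ((fun x => (c i)^-1 * x) @^-1` A).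
      rewrite -[X in measurable X]setTI.
      by apply: measurable_funM.
    exact: (independent_chaos (bi i) dD vi ni mA' mB).
  rewrite pnormZ//; last exact: measurable_chaos.
  have [ci0|ci0] := eqVneq (c i) 0.
    by rewrite ci0 invr0 normr0 !mul0e lee_fin.
  rewrite ger0_norm ?invr_ge0 ?sqrtr_ge0// EFinM.
  apply: lee_pmul => //.
  - by rewrite mule_ge0 ?pnorm_ge0// lee_fin invr_ge0 sqrtr_ge0.
  - exact: pnorm_ge0.
  (* Multiplied by [c i], this is the induction hypothesis for [bi i]. *)
  - rewrite lee_pdivrMl ?lt_def ?ci0 ?sqrtr_ge0// -EFinM mulrC.
    by apply: IH => //; exact: ltnW.
  - exact: Xv.
Qed.

End Bound.
End MomentBound.

(** * Passage to the limit by Fatou's lemma *)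

Section Fatou.
Context (R : realType) (disp : measure_display) (T : measurableType disp)
        (P : probability T R).

(* Unlike [ge0_le_integral], no measurability is required: the integral of a
   nonnegative function is a supremum over the simple functions below it. *)
Lemma ge0_le_integral_nonmeasurable (f g : T -> \bar R) :
  (forall w, 0 <= f w)%E -> (forall w, f w <= g w)%E ->
  (\int[P]_w f w <= \int[P]_w g w)%E.
Proof.
move=> f0 fg; rewrite !ge0_integralTE//; last first.
  by move=> w; exact: le_trans (fg w).
apply: le_ereal_sup => _ [h hf <-]; exists h => // w.
exact: le_trans (fg w).
Qed.

Lemma limn_einf_ge0 (u : nat -> \bar R) :
  (forall n, 0 <= u n)%E -> (0 <= limn_einf u)%E.
Proof.
move=> u0; rewrite limn_einf_lim; apply: lime_ge; first exact: is_cvg_einfs.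
by apply: nearW => n; apply: le_ereal_inf_tmp => _ [m _ <-].
Qed.

(** At a nonzero limit equality holds by continuity of the power; at a zero limit the left side is
    0. *)
Lemma normr_powR_le_limn_einf (p : R) (u : nat -> R) : 0 < p -> cvgn u ->
  ((`|limn u| `^ p)%:E <= limn_einf (fun n => (`|u n| `^ p)%:E))%E.
Proof.
move=> p0 cu.
have [->|l0] := eqVneq (limn u) 0.
  rewrite normr0 powR0 ?gt_eqF//; apply: limn_einf_ge0 => n.
  by rewrite lee_fin powR_ge0.
have cabs : `|u n| @[n --> \oo] --> `|limn u| by exact: cvg_norm.
have cpow : {for `|limn u|, continuous (@powR R ^~ p)}.
  apply: differentiable_continuous; apply/derivable1_diffP.
  by apply: derivable_powR; rewrite in_itv/= andbT normr_gt0.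
have cup : `|u n| `^ p @[n --> \oo] --> `|limn u| `^ p.
  exact: (cvg_comp _ _ cabs cpow).
have : (`|u n| `^ p)%:E @[n --> \oo] --> (`|limn u| `^ p)%:E.
  by apply: cvg_EFin; first exact: nearW.
by move=> /cvg_limn_einf_sup[-> _].
Qed.

(** Fatou's lemma bounds the integral of the lower limit [h], which dominates the limit wherever the
    sequence converges. *)
Lemma pnorm_lim_le (p c : R) (f : nat -> T -> R) : 0 < p -> 0 <= c ->
  (forall n, measurable_fun setT (f n)) ->
  (forall n, pnorm P p (f n) <= c%:E)%E ->
  {ae P, forall w, cvgn (f ^~ w)} ->
  (pnorm P p (fun w => limn (f ^~ w)) <= c%:E)%E.
Proof.
move=> p0 c0 mf fc [N [mN PN0 cN]].
have int_le n : (\int[P]_w (`|f n w| `^ p)%:E <= (c `^ p)%:E)%E.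
  have := fc n; rewrite pnormE => H.
  rewrite -[leLHS]poweRe1; last by apply: integral_ge0 => w _; rewrite lee_fin powR_ge0.
  rewrite -(mulVf (lt0r_neq0 p0)) poweRrM -poweR_EFin.
  apply: gt0_ler_poweR => //; first exact: ltW.
  - by rewrite in_itv/= poweR_ge0 leey.
  - by rewrite in_itv/= lee_fin c0 leey.
have mfp n : measurable_fun setT (fun w => (`|f n w| `^ p)%:E).
  exact: (measurableT_comp (measurable_normr_powR p)).
pose h w := limn_einf (fun n => (`|f n w| `^ p)%:E).
have h0 w : (0 <= h w)%E.
  by apply: limn_einf_ge0 => n; rewrite lee_fin powR_ge0.
have mh : measurable_fun setT h.
  apply: (emeasurable_fun_cvg
    (fun n w => einfs (fun m => (`|f m w| `^ p)%:E) n)) => [n|w _].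
    exact: (@measurable_fun_einfs _ _ _ _ (fun m w => (`|f m w| `^ p)%:E)).
  by rewrite /h limn_einf_lim; exact: is_cvg_einfs.
have ihc : (\int[P]_w h w <= (c `^ p)%:E)%E.
  apply: (@le_trans _ _ (limn_einf (fun n => \int[P]_w (`|f n w| `^ p)%:E)))%E.
    by apply: fatou => // n w _; rewrite lee_fin powR_ge0.
  rewrite limn_einf_lim; apply: lime_le; first exact: is_cvg_einfs.
  apply: nearW => n; apply: le_trans (int_le n); apply: ereal_inf_lbound.
  by exists n => /=.
(* Adding +oo on the null set [N] dominates the limit everywhere and leaves the integral
   unchanged. *)
pose g w := (h w + ((cst +oo%E : T -> \bar R) \_ N) w)%E.
have g0 w : (0 <= ((cst +oo%E : T -> \bar R) \_ N) w)%E.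
  by rewrite patchE; case: ifP => _; rewrite /= ?leey ?lexx.
have mg : measurable_fun setT ((cst +oo%E : T -> \bar R) \_ N).
  by apply/(measurable_restrictT _ mN).1; exact: measurable_cst.
have igc : (\int[P]_w g w <= (c `^ p)%:E)%E.
  rewrite ge0_integralD//.
  rewrite -(@integral_mkcond _ _ _ P N (cst +oo%E)) integral_cst//.
  have -> : (P : {measure set T -> \bar R}) N = 0%E by exact: PN0.
  by rewrite mule0 adde0.
rewrite pnormE.
have -> : c%:E = ((c `^ p)%:E `^ p^-1)%E.
  by rewrite poweR_EFin -powRrM divff ?gt_eqF// powRr1.
apply: gt0_ler_poweR.
- by rewrite invr_ge0 ltW.
- by rewrite in_itv/= leey andbT; apply: integral_ge0 => w _; rewrite lee_fin powR_ge0.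
- by rewrite in_itv/= leey andbT lee_fin powR_ge0.
apply: le_trans igc; apply: ge0_le_integral_nonmeasurable.
  by move=> w; rewrite lee_fin powR_ge0.
move=> w; rewrite /g patchE; case: ifPn => wN.
  by rewrite addey ?leey// gt_eqF// (lt_le_trans _ (h0 w)).
rewrite adde0; apply: normr_powR_le_limn_einf => //.
by apply: contrapT => ncv; move: wN; rewrite notin_setE; apply; exact: cN.
Qed.

End Fatou.

(** * Multi-indices and recursion on the largest entry *)

Section Multiindices.

Lemma IsetP (d N : nat) (I : d.-tuple nat) :
  Iset d (Some N) I <-> sorted ltn I && all (fun i => 1 <= i <= N)%N I.
Proof.
split=> [[-> H]|/andP[sI /all_tnthP H]].
  by apply/all_tnthP => m; have [-> ->] := H m.
by split => // m; have /andP[] := H m.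
Qed.

(** The last entry is the largest, so the earlier ones are at most [i - 1]. *)
Lemma Iset_rconsP (d N i : nat) (I : d.-tuple nat) :
  Iset d.+1 (Some N) [tuple of rcons I i] <->
  Iset d (Some i.-1) I /\ (1 <= i <= N)%N.
Proof.
split=> [/IsetP|[/IsetP H /andP[i1 iN]]].
  (* As [ltn] is transitive, sortedness is a pairwise condition, which splits along [rcons]. *)
  rewrite /= sorted_pairwise; last exact: ltn_trans.
  rewrite pairwise_rcons all_rcons -sorted_pairwise; last exact: ltn_trans.
  move=> /andP[/andP[Ii sI] /andP[iN IN]]; split => //; apply/IsetP.
  rewrite sI /=; apply/allP => j jI; have /andP[-> _] := allP IN j jI.
  by have := allP Ii j jI; case: (i) => // i'; rewrite ltnS.
apply/IsetP; rewrite /= sorted_pairwise; last exact: ltn_trans.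
rewrite pairwise_rcons all_rcons -sorted_pairwise; last exact: ltn_trans.
case/andP: H => -> /allP H; rewrite i1 iN andbT /=; apply/andP; split.
  by apply/allP => j /H /andP[_]; case: (i) i1 => // i' _; rewrite ltnS.
apply/allP => j /H /andP[-> /= ji]; apply: leq_trans ji _.
exact: leq_trans (leq_pred i) iN.
Qed.

Lemma tuple_rconsP (T : Type) (d : nat) (I : d.+1.-tuple T) :
  exists (I' : d.-tuple T) (x : T), I = [tuple of rcons I' x].
Proof.
case: I => s; case: (lastP s) => [//|s' x] ss.
have s's : size s' == d by move: ss; rewrite size_rcons eqSS.
by exists (Tuple s's), x; exact/val_inj.
Qed.

Lemma Iset0 (N : nat) : Iset 0 (Some N) = [set [tuple]].
Proof.
apply/seteqP; split=> [I _|_ ->]; first exact: tuple0.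
exact/IsetP.
Qed.

Lemma IsetS0 (d : nat) : Iset d.+1 (Some 0%N) = set0.
Proof.
apply/seteqP; split=> // I; have [I' [x ->]] := tuple_rconsP I.
by move=> /Iset_rconsP[_ /andP[x1]]; rewrite leqNgt x1.
Qed.

Lemma IsetS (d N : nat) : Iset d.+1 (Some N.+1) =
  Iset d.+1 (Some N) `|`
  [set [tuple of rcons I N.+1] | I in Iset d (Some N)].
Proof.
apply/seteqP; split=> I; have [I' [x ->]] := tuple_rconsP I.
  move=> /Iset_rconsP[II /andP[x1]]; rewrite leq_eqVlt => /predU1P[xN|xN].
    by right; exists I' => //; [rewrite xN in II|rewrite xN].
  by left; apply/Iset_rconsP; split; rewrite ?x1.
case=> [/Iset_rconsP[II /andP[x1 xN]]|[J IJ <-]]; apply/Iset_rconsP.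
  by split => //; rewrite x1 leqW.
by split => //=.
Qed.

Lemma finite_Iset (d N : nat) : finite_set (Iset d (Some N)).
Proof.
elim: d N => [|d IHd] N; first by rewrite Iset0; exact: finite_set1.
elim: N => [|N IHN]; first by rewrite IsetS0; exact: finite_set0.
by rewrite IsetS finite_setU; split => //; exact: finite_image.
Qed.

(** Multi-indices are grouped by their last entry, by induction on [N]; [f] takes plain sequences so
    that one function serves tuples of both lengths. *)
Lemma fsbig_IsetS (V : nmodType) (d N : nat) (f : seq nat -> V) :
  \sum_(I \in Iset d.+1 (Some N)) f I =
  \sum_(1 <= i < N.+1) \sum_(I \in Iset d (Some i.-1)) f (rcons I i).
Proof.
elim: N => [|N IH]; first by rewrite IsetS0 fsbig_set0 big_geq.
rewrite big_nat_recr//= -IH IsetS fsbigU /=; last 3 first.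
- exact: finite_Iset.
- exact/finite_image/finite_Iset.
- move=> _ [/[swap] -[J IJ <-] /Iset_rconsP[_]].
  by rewrite ltnn andbF.
congr (_ + _); apply: reindex_fsbig; split.
- by move=> I II; exists I.
- move=> I J _ _ /(congr1 val) /= /rcons_inj[IJ]; exact/val_inj.
- by move=> _ [J IJ <-]; exists J.
Qed.

Lemma chaosE (R : realType) (T : Type) (X : nat -> nat -> T -> R) d b N w :
  chaos X d b N w =
  \sum_(I \in Iset d (Some N)) (b I * \prod_(m < d) X (nth 0%N I m) m w).
Proof.
elim: d b N => [|d IH] b N.
  by rewrite Iset0 fsbig_set1 big_ord0 mulr1.
rewrite (fsbig_IsetS d N (fun s => b s * \prod_(m < d.+1) X (nth 0%N s m) m w)) /=.
apply: eq_bigr => i _; rewrite IH mulr_fsuml; apply: eq_fsbigr => I _.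
rewrite -mulrA; congr (_ * _); rewrite big_ord_recr /=.
congr (_ * _); last by rewrite nth_rcons size_tuple ltnn eqxx.
by apply: eq_bigr => m _; rewrite nth_rcons size_tuple ltn_ord.
Qed.

Lemma sqsumE (R : realType) d (b : seq nat -> R) N :
  sqsum d b N = \sum_(I \in Iset d (Some N)) b I ^+ 2.
Proof.
elim: d b N => [|d IH] b N; first by rewrite Iset0 fsbig_set1.
rewrite (fsbig_IsetS d N (fun s => b s ^+ 2)) /=.
by apply: eq_bigr => i _; rewrite IH.
Qed.

(** I(d,N) is a finite subset of I(d,n), over which the squares sum to 1; it may be a proper subset,
    hence the inequality. *)
Lemma sqsum_Bset_le1 (R : realType) d n (b : seq nat -> R) N :
  Bset R d n b -> (if n is Some M then (N <= M)%N else true) ->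
  sqsum d b N <= 1.
Proof.
move=> Bb nN; rewrite -lee_fin -[1%:E]Bb; apply: esum_ge.
exists (Iset d (Some N)).
  split; first exact: finite_Iset.
  move=> I [sI HI]; split => // m; have [i1 iN] := HI m; split => //.
  by case: n nN {Bb} => // M NM; exact: leq_trans iN NM.
by rewrite sqsumE -fsumEFin//; exact: finite_Iset.
Qed.

End Multiindices.

(** * Suprema, norms of vectors and the constant K_M *)

Section Suprema.
Context (R : realType).
Implicit Types (A : set (\bar R)) (x c : \bar R).

Lemma nnsup_ubound A x : A x -> (x <= nnsup A)%E.
Proof. by move=> Ax; apply: ereal_sup_ubound; right. Qed.

Lemma nnsup_ge0 A : (0 <= nnsup A)%E.
Proof. by apply: ereal_sup_ubound; left. Qed.

Lemma nnsup_le A c : (0 <= c)%E -> (forall x, A x -> (x <= c)%E) -> (nnsup A <= c)%E.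
Proof. by move=> c0 Ac; apply: ge_ereal_sup => x [->//|/Ac]. Qed.

End Suprema.

Section Norms.
Context (R : realType) (disp : measure_display) (T : measurableType disp)
        (P : probability T R) (n : option nat).
Implicit Types X : nat -> {RV P >-> R}.

(** A single exponent suffices, here the midpoint [p] of (2, r). If the ratios had supremum t < 1,
    every |X_i|_p would be at most t nu(p) < nu(p), although nu(p) is their supremum. *)
Lemma Gnorm_vector_ge1 X (r : R) : 2 < r -> classG r (sup_pnorm n X) ->
  (1 <= Gnorm_vector n X (sup_pnorm n X) r)%E.
Proof.
move=> r2 [_ nuP _ _]; pose p := (2 + r) / 2.
have p2 : 2 < p by rewrite /p ltr_pdivlMr// mulr_natr mulr2n ltrD2l.
have pr : p < r by rewrite /p ltr_pdivrMr// mulr_natr mulr2n ltrD2r.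
have [|v0 voo] := nuP p; first by rewrite pr (ltW (lt_trans _ p2))// ltr1n.
set t := nnsup [set (pnorm P p (X i) / sup_pnorm n X p)%E | i in indices n].
apply: (@le_trans _ _ t); last first.
  by apply: nnsup_ubound; exists p => //=; rewrite p2.
have t0 : (0 <= t)%E by exact: nnsup_ge0.
rewrite leNgt; apply/negP => t1.
have tE : t = (fine t)%:E.
  by rewrite fineK// ge0_fin_numE// (lt_trans t1)// ltry.
have vE : sup_pnorm n X p = (fine (sup_pnorm n X p))%:E.
  by rewrite fineK// ge0_fin_numE// ltW.
set v := fine _ in vE; rewrite vE lte_fin in v0.
rewrite tE lte_fin in t1; rewrite tE lee_fin in t0.
suff : (sup_pnorm n X p <= (fine t * v)%:E)%E.
  by rewrite vE lee_fin leNgt gtr_pMl// t1.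
apply: nnsup_le; first by rewrite lee_fin mulr_ge0// ltW.
move=> _ [i ni <-]; rewrite EFinM -lee_pdivrMr// -tE.
by apply: nnsup_ubound; exists i => //; rewrite vE inver gt_eqF.
Qed.

(** Some |X_i|_p is positive; coefficients equal to 1 at [i] and 0 elsewhere give 0 < |X_i|_p <= K
    sup_j |X_j|_p, which excludes K < 0. *)
Lemma KM_bound_ge0 (F : nat -> set (set T)) X (p K : R) :
  is_filtration F -> martingale_differences n F X ->
  (0 < sup_pnorm n X p)%E -> KM_bound p K -> 0 <= K.
Proof.
move=> FF MX Xp KK.
have [i [ni Xi]] : exists i, indices n i /\ (0 < pnorm P p (X i))%E.
  apply: contrapT => /forallNP H; move: Xp; rewrite ltNge => /negP; apply.
  apply: nnsup_le => // _ [i ni <-]; rewrite leNgt; apply/negP => Xi.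
  by apply: (H i).
have [i1 iN] := ni.
(* The sequence is cut at [i] to obtain a finite length, with [i] as its last index. *)
have MXi : martingale_differences (Some i) F X.
  move=> j [j1 ji]; apply: MX; split => //.
  by case: (n) iN => // N; exact: leq_trans.
have delta (f : nat -> R) : \sum_(1 <= j < i.+1) (j == i)%:R * f j = f i.
  rewrite big_nat_recr//= eqxx mul1r big_nat big1 ?add0r// => j /andP[_ ji].
  by rewrite ltn_eqF// mul0r.
have := KK _ _ P i F X (fun j => (j == i)%:R) FF MXi.
rewrite (_ : (fun w => _) = X i); last by apply/funext => w; rewrite delta.
have -> : \sum_(1 <= j < i.+1) ((j == i)%:R : R) ^+ 2 = 1.
  rewrite -[RHS](delta (fun=> 1)); apply: eq_bigr => j _.
  by case: (_ == _); rewrite ?expr1n ?mulr1 ?expr0n ?mul0r.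
move=> /(_ erefl) H; rewrite leNgt; apply/negP => K0.
have Ssup : (0 < sup_pnorm (Some i) X p)%E.
  by apply: (lt_le_trans Xi); apply: nnsup_ubound; exists i.
have : (K%:E * sup_pnorm (Some i) X p < 0)%E by rewrite nmule_rlt0.
by rewrite ltNge (le_trans _ H)// pnorm_ge0.
Qed.

(** Every admissible [K] gives the bound, and division by [s] carries it to their infimum [k]. For
    [s = 0] any admissible [K] will do; one exists, since an empty infimum would be +oo. *)
Lemma pnorm_KM (p k s : R) (F : nat -> set (set T)) X (a : nat -> R) N :
  (forall K, KM_bound p K -> 0 <= K) -> KM p = k%:E -> is_filtration F ->
  martingale_differences (Some N) F X ->
  \sum_(1 <= i < N.+1) a i ^+ 2 = 1 -> 0 <= s ->
  (forall i, (1 <= i <= N)%N -> (pnorm P p (X i) <= s%:E)%E) ->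
  (pnorm P p (fun w => \sum_(1 <= i < N.+1) a i * X i w)%R <= (k * s)%:E)%E.
Proof.
move=> K0 KMk FF MX a1 s0 Xs; set x := pnorm _ _ _.
have xK K : KM_bound p K -> (x <= (K * s)%:E)%E.
  move=> KK; apply: (le_trans (KK _ _ P N F X a FF MX a1)); rewrite EFinM.
  apply: lee_wpmul2l; first by rewrite lee_fin K0.
  apply: nnsup_le; first by rewrite lee_fin.
  by move=> _ [i [i1 iN] <-]; apply: Xs; rewrite i1.
have [K KK] : exists K, KM_bound p K.
  apply: contrapT => /forallNP H; move: KMk; rewrite /KM.
  rewrite (_ : [set K%:E | K in KM_bound p] = set0) ?ereal_inf0//.
  by apply/seteqP; split => // y [K KK _]; exact: (H K).
have [s00|sn0] := eqVneq s 0.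
  by have := xK _ KK; rewrite s00 !mulr0.
have s_gt0 : 0 < s by rewrite lt_def sn0.
rewrite EFinM -lee_pdivrMr// -KMk; apply: le_ereal_inf_tmp => _ [K' KK' <-].
by rewrite lee_pdivrMr// -EFinM; exact: xK.
Qed.

End Norms.

(** * Conclusion: the estimate for each exponent p in (2, s) *)

Lemma prode_ge1 (R : realType) (I : Type) (s : seq I) (f : I -> \bar R) :
  (forall i, 1 <= f i)%E -> (1 <= \prod_(i <- s) f i)%E.
Proof.
move=> f1; apply: (big_ind (fun x => 1 <= x)%E) => //= x y x1 y1.
by rewrite -[leLHS]mule1 lee_pmul.
Qed.

Lemma expey (R : realType) (d : nat) : (0 < d)%N -> (+oo ^+ d = +oo :> \bar R)%E.
Proof.
case: d => // d _; elim: d => [|d IH]; first by rewrite expeS expe0 mule1.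
by rewrite expeS IH mulyy.
Qed.

Theorem theorem4p3 (R : realType) (disp : measure_display)
    (T : measurableType disp) (P : probability T R)
    (d : nat) (n : option nat) (F : nat -> set (set T))
    (xi : nat -> 'I_d -> {RV P >-> R}) (r : 'I_d -> R)
    (nu := fun m : 'I_d => sup_pnorm n (fun i => xi i m))
    (s := \big[mine/+oo%E]_(m < d) (r m)%:E) :
  (1 <= d)%N ->
  (if n is Some N then (1 <= N)%N else true) ->
  is_filtration F ->
  (forall m : 'I_d, martingale_differences n F (fun i => xi i m)) ->
  independent_vectors n (fun m i => xi i m) ->
  (forall m : 'I_d, 2 < r m) ->
  (forall m : 'I_d, classG (r m) (nu m)) ->
  (nnsup [set Gnorm P (Q xi n b) (zeta nu) s
        | b in [set b | Bset R d n b /\ Q_defined xi n b]]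
   <= \prod_(m < d) Gnorm_vector n (fun i => xi i m) (nu m) (r m))%E.
Proof.
move=> d1 n1 FF Mxi Ixi r2 nuG.
apply: (@le_trans _ _ 1%E); last first.
  by apply: prode_ge1 => m; exact: Gnorm_vector_ge1.
apply: nnsup_le => // _ [b [Bb Qb] <-].
apply: nnsup_le => // _ [p [p2 ps] <-].
have p0 : 0 < p by exact: lt_trans p2.
have pr m : p < r m.
  by rewrite -lte_fin; move/bigmin_gtP: ps => [_]; exact.
have [nu0 nuoo] : (forall m, 0 < nu m p)%E /\ (forall m, nu m p < +oo)%E.
  by split => m; have [_ /(_ p)] := nuG m;
    (case; first by rewrite (pr m) (ltW (lt_trans _ p2))// ltr1n).
(* As [d >= 1], the index 0 exists; [ord] sends numbers out of range to it, so that vectors can be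
   indexed by [nat]. *)
pose o := Ordinal d1.
pose ord (m : nat) : 'I_d := insubd o m.
pose v m := fine (nu (ord m) p).
have nuE m : nu m p = (v m)%:E.
  by rewrite /v /ord valKd fineK// ge0_fin_numE// ltW.
have v0 m : 0 <= v m by rewrite fine_ge0// ltW.
have K0 K : KM_bound p K -> 0 <= K.
  exact: KM_bound_ge0 FF (Mxi o) (nu0 o).
have prodE : (\prod_(m < d) nu m p = (\prod_(m < d) v m)%:E)%E.
  by rewrite -prodEFin; apply: eq_bigr => m _; rewrite nuE.
have prod0 : (0 < \prod_(m < d) nu m p)%E.
  rewrite prodE lte_fin; apply: prodr_gt0 => m _.
  by rewrite -lte_fin -nuE.
have : (0 <= KM p)%E by apply: le_ereal_inf_tmp => _ [K /K0 HK <-]; rewrite lee_fin.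
(* If K_M(p) is infinite then so is [zeta], and the quotient is 0. *)
rewrite /zeta; case KMk : (KM p) => [k| |] //; last first.
  by move=> _; rewrite expey// gt0_mulye// invey mule0.
rewrite lee_fin => k0.
rewrite -EFin_expe prodE -EFinM; set z := _ * _.
suff Qz : (pnorm P p (Q xi n b) <= z%:E)%E.
  have z0 : 0 <= z by rewrite mulr_ge0// ?exprn_ge0//; apply: prodr_ge0.
  (* If [z] is 0 then so is |Q|_p, and 0 times the inverse of [z] is 0. *)
  have [z00|zn0] := eqVneq z 0.
    suff -> : pnorm P p (Q xi n b) = 0%E by rewrite mul0e.
    by apply/eqP; rewrite eq_le pnorm_ge0 andbT -[leRHS]/(0%:E) -z00.
  by rewrite inver (negbTE zn0) lee_pdivrMr ?mul1e// lt_def zn0.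
pose X i m := xi i (ord m).
(* [b] is extended by 0 to sequences whose length is not [d]. *)
pose b' (q : seq nat) : R := oapp b 0 (insub q).
have b'E (I : d.-tuple nat) : b' I = b I by rewrite /b' valK.
have QE N w : Qfin xi N b w = chaos X d b' N w.
  rewrite chaosE; apply: eq_fsbigr => I _; rewrite b'E; congr (_ * _).
  by apply: eq_bigr => m _; rewrite /X /ord valKd (tnth_nth 0%N).
have Bb' : Bset R d n b'.
  by rewrite /Bset/= -[RHS]Bb; apply: eq_esum => I _; rewrite b'E.
have IX : independent_vectors n (fun (m : 'I_d) i => X i m).
  rewrite (_ : (fun _ _ => _) = (fun m i => xi i m))//.
  by apply/funext => m; apply/funext => i; rewrite /X /ord valKd.
have chaos_le N : (if n is Some M then (N <= M)%N else true) ->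
    (pnorm P p (chaos X d b' N) <= z%:E)%E.
  move=> nN; apply: (le_trans (@pnorm_chaos _ _ _ P d n F X FF _ IX p k v
    p0 k0 v0 _ _ d b' N (leqnn d) _)).
  - by move=> m _; exact: Mxi.
  - move=> m i md ni; rewrite /X /v fineK; last by rewrite ge0_fin_numE// ltW.
    by apply: nnsup_ubound; exists i.
  - by move=> M theta a c Mth a1 c0 thc; exact: pnorm_KM K0 KMk FF Mth a1 c0 thc.
  - move=> i /andP[i1 iN]; split => //.
    by case: (n) nN => // M; exact: leq_trans.
  (* The remaining factor, the root of the sum of squares up to [N], is at most 1. *)
  rewrite lee_fin -[leRHS]mulr1; apply: ler_wpM2l.
    by rewrite mulr_ge0// ?exprn_ge0//; apply: prodr_ge0.
  by rewrite -sqrtr1 ler_wsqrtr// (sqsum_Bset_le1 Bb').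
case nE : n Qb chaos_le => [N|] Qb chaos_le.
  rewrite (_ : Q _ _ _ = chaos X d b' N); last by apply/funext => w; exact: QE.
  exact: chaos_le.
rewrite (_ : Q _ _ _ = (fun w => limn (fun N => chaos X d b' N w))); last first.
  by apply/funext => w /=; congr (limn _); apply/funext => N; exact: QE.
apply: pnorm_lim_le => // [|N|N|].
- by rewrite mulr_ge0// ?exprn_ge0//; apply: prodr_ge0.
- exact: measurable_chaos.
- exact: chaos_le.
apply: filterS Qb => w; rewrite (_ : (fun N => _) = (fun N => chaos X d b' N w))//.
by apply/funext => N; exact: QE.
Qed.
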